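(* Let $\prec$ be a suffix-invariant order on $F$ and let $I\le\mathcal{A}=K[F]$ be a right ideal. Then: (1) The minimal Schreier transversal $T_I$ consists precisely of those words $u\in F$ that have $\prec_{\max}$-minimal support in their $I$-coset (i.e. such that $\{u\}\preceq_{\max}\mathrm{supp}(g)$ for every $g\in u+I$). (2) For every $f\in\mathcal{A}$, the remainder $\phi_I(f)$ is the unique element of $f+I$ with $\prec_{\max}$-minimal support. (3) For every $\alpha<\omega_I$, the element $f_\alpha$ is the unique monic element of $I\setminus I_\alpha$ with $\prec_{\max}$-minimal support.
   Context: $K$ is a field, $F$ is a free group with finite basis $S$ (elements are reduced words in $S\cup S^{-1}$), and $\mathcal{A}=K[F]$. The support $\mathrm{supp}(f)$ of $f\in\mathcal{A}$ is the set of words with nonzero coefficient in $f$; $f$ is supported on $T\subseteq F$ if $\mathrm{supp}(f)\subseteq T$. $\mathrm{Sp}_K(T)$ is the $K$-span of $T$. A well-order $\prec$ on $F$ is suffix-invariant if whenever $u,u',v\in F$ satisfy $u\prec u'$ and there is no cancellation in the product $u'v$, then $uv\prec u'v$. An exposure order on $F$ is a well-order $\prec$ such that $u\preceq v$ whenever $u$ is a prefix of $v$; every suffix-invariant order is an exposure order. For an exposure order $\prec$: for distinct subsets $A,B\subseteq F$, $A\prec_{\min}B$ if $\min(A\triangle B)\in A$ (a total order on subsets); for distinct finite subsets, $A\prec_{\max}B$ if $\max(A\triangle B)\in B$ (a well-order on finite subsets). For $0\ne f\in\mathcal{A}$, the head term of $f$ is the $\prec$-maximal word in $\mathrm{supp}(f)$;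 $f$ is monic if its head term has coefficient $1$. A Schreier transversal for $I$ is a prefix-closed subset $T\subseteq F$ such that $\mathrm{Sp}_K(T)\cap I=\{0\}$ and every $I$-coset in $\mathcal{A}$ intersects $\mathrm{Sp}_K(T)$. The set of Schreier transversals for $I$ has a $\prec_{\min}$-minimum, denoted $T_I=T_{I,\prec}$ (the minimal Schreier transversal). $\phi_I:\mathcal{A}\to\mathrm{Sp}_K(T_I)$ sends $f$ to the unique element of $f+I$ supported on $T_I$. Exposure process of $I$: define $f_\alpha\in I$ by transfinite recursion. Given $f_\beta$ for all $\beta<\alpha$, let $I_\alpha$ be the right ideal generated by $\{f_\beta:\beta<\alpha\}$. If $I_\alpha=I$, stop and set $\omega_I:=\alpha$. Otherwise let $f_\alpha$ be the unique monic element of $I$ whose support is $\prec_{\max}$-minimal among the monic elements of $I$ supported on $T_{I_\alpha}$ (it exists and is unique, and the process always stops). *)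

(* Defs.v *)
From HB Require Import structures.
From mathcomp Require Import all_boot all_order all_algebra.
From mathcomp Require Import finmap.
From mathcomp Require Import all_classical wochoice.
From mathcomp Require Import monalg.

Set Implicit Arguments.
Unset Strict Implicit.
Unset Printing Implicit Defensive.

Import GRing.Theory.

Local Open Scope classical_set_scope.
Local Open Scope ring_scope.

(* Free groups as groups of reduced words: the letter (s, true) stands for the
   basis element s and (s, false) for its inverse. *)
Section FreeGroup.
Variable S : choiceType.
Implicit Types (x y : S * bool) (u v w : seq (S * bool)).

Definition linv x : S * bool := (x.1, ~~ x.2).

Definition reduced : pred (seq (S * bool)) := sorted (fun x y => y != linv x).

Record free_group := FreeGroup { word :> seq (S * bool); _ : reduced word }.

HB.instance Definition _ := [isSub for word].
HB.instance Definition _ := [Choice of free_group by <:].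

Definition consr x w :=
  if w is y :: w' then if y == linv x then w' else x :: w else [:: x].

Lemma linvK : involutive linv.
Proof. by case=> s b; rewrite /linv /= negbK. Qed.

Lemma reduced_consr x w : reduced w -> reduced (consr x w).
Proof.
by case: w => //= y w; case: ifP => [_ /path_sorted|/negbT /= -> ->].
Qed.

Lemma reduced_mul u v : reduced v -> reduced (foldr consr v u).
Proof. by move=> rv; elim: u => //= x u; apply: reduced_consr. Qed.

Lemma consrK x w : reduced w -> consr (linv x) (consr x w) = w.
Proof.
case: w => [|y w] /=; first by rewrite linvK eqxx.
case: (eqVneq y (linv x)) => [->|_]; last by rewrite /= linvK eqxx.
case: w => [//|z w] /= /andP[]; by rewrite /= => /negbTE->.
Qed.

Lemma mul_cat u v : reduced (u ++ v) -> foldr consr v u = u ++ v.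
Proof.
elim: u => //= x u IH ruv; have -> := IH (path_sorted ruv).
by case: (u ++ v) ruv => //= y w /andP[/negbTE->].
Qed.

Lemma mul_consr x u w :
  reduced w -> foldr consr w (consr x u) = consr x (foldr consr w u).
Proof.
move=> rw; case: u => //= y u; case: eqP => //= ->.
by have := consrK (linv x) (reduced_mul u rw); rewrite linvK => ->.
Qed.

Lemma mulA_word u v w : reduced w ->
  foldr consr w (foldr consr v u) = foldr consr (foldr consr w v) u.
Proof. by move=> rw; elim: u => //= x u IH; rewrite mul_consr// IH. Qed.

Definition winv w := rev (map linv w).

Lemma reduced_inv w : reduced w -> reduced (winv w).
Proof.
rewrite /reduced /winv rev_sorted sorted_map; apply: sub_sorted => x y /=.
by rewrite /relpre /= linvK eq_sym.
Qed.

Lemma winvK : involutive winv.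
Proof. by move=> w; rewrite /winv map_rev revK mapK//; apply: linvK. Qed.

Lemma mulV_word w : foldr consr w (winv w) = [::].
Proof.
by elim: w => //= x w IH; rewrite /winv /= rev_cons foldr_rcons /= linvK eqxx.
Qed.

Definition fg_mul (u v : free_group) : free_group :=
  FreeGroup (reduced_mul u (valP v)).
Definition fg_one : free_group := @FreeGroup [::] isT.
Definition fg_inv (u : free_group) : free_group :=
  FreeGroup (reduced_inv (valP u)).

Fact fg_mulA : associative fg_mul.
Proof. by move=> u v w; apply/val_inj; rewrite /= mulA_word//; apply: valP. Qed.

Fact fg_mul1 : left_id fg_one fg_mul.
Proof. by move=> u; apply/val_inj. Qed.

Fact fg_mulg1 : right_id fg_one fg_mul.
Proof.
by move=> u; apply/val_inj; rewrite /= mul_cat ?cats0//; apply: valP.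
Qed.

Fact fg_mulV : left_inverse fg_one fg_inv fg_mul.
Proof. by move=> u; apply/val_inj; rewrite /= mulV_word. Qed.

Fact fg_mulgV : right_inverse fg_one fg_inv fg_mul.
Proof.
move=> u; apply/val_inj => /=.
by have := mulV_word (winv (word u)); rewrite winvK.
Qed.

HB.instance Definition _ := isGroup.Build free_group
  fg_mulA fg_mul1 fg_mulg1 fg_mulV fg_mulgV.

End FreeGroup.

(* The monoid algebra product of multinomials requires 1 to be the only unit
   of the monoid, so the ring structure is rebuilt here for groups, on an
   alias of the module of finitely supported functions. *)
Definition group_algebra (K : nzRingType) (G : groupType) := {malg K[G]}.

Notation "{ 'galg' K [ G ] }" := (group_algebra K G)
  (at level 0, K at level 2, format "{ 'galg'  K [ G ] }") : type_scope.

Section GroupAlgebra.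
Variables (K : nzRingType) (G : groupType).
Implicit Types (f g h : {malg K[G]}) (u v : G).

HB.instance Definition _ := GRing.Lmodule.on {galg K[G]}.

Definition gmul f g : {malg K[G]} :=
  \sum_(u <- msupp f) \sum_(v <- msupp g) << f@_u * g@_v *g (u * v)%g >>.

Lemma gmulw (d1 d2 : {fset G}) f g :
  (msupp f `<=` d1)%fset -> (msupp g `<=` d2)%fset ->
  gmul f g = \sum_(u <- d1) \sum_(v <- d2) << f@_u * g@_v *g (u * v)%g >>.
Proof.
move=> le_d1 le_d2; rewrite /gmul (big_fset_incl _ le_d1) /=.
  apply/eq_bigr=> u _; apply/big_fset_incl => // v _ /mcoeff_outdom ->.
  by rewrite mulr0 monalgU0.
move=> u _ /mcoeff_outdom fu.
by rewrite big1 // => v _; rewrite fu mul0r monalgU0.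
Qed.

Lemma gmulUU a b u v :
  gmul << a *g u >> << b *g v >> = << a * b *g (u * v)%g >>.
Proof. by rewrite (gmulw msuppU_le msuppU_le) !big_seq_fset1 !mcoeffUU. Qed.

Fact gmulDl : left_distributive gmul +%R.
Proof.
move=> f g h; rewrite (gmulw (msuppD_le _ _) (fsubset_refl _)).
rewrite (gmulw (fsubsetUl _ (msupp g)) (fsubset_refl (msupp h))).
rewrite (gmulw (fsubsetUr (msupp f) _) (fsubset_refl (msupp h))).
rewrite -big_split /=; apply/eq_bigr=> u _.
rewrite -big_split /=; apply/eq_bigr=> v _.
by rewrite mcoeffD mulrDl monalgUD.
Qed.

Fact gmulDr : right_distributive gmul +%R.
Proof.
move=> f g h; rewrite (gmulw (fsubset_refl _) (msuppD_le _ _)).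
rewrite (gmulw (fsubset_refl (msupp f)) (fsubsetUl _ (msupp h))).
rewrite (gmulw (fsubset_refl (msupp f)) (fsubsetUr (msupp g) _)).
rewrite -big_split /=; apply/eq_bigr=> u _.
rewrite -big_split /=; apply/eq_bigr=> v _.
by rewrite mcoeffD mulrDr monalgUD.
Qed.

Fact gmul0r f : gmul 0 f = 0.
Proof. by rewrite /gmul msupp0 big_seq_fset0. Qed.

Fact gmulr0 f : gmul f 0 = 0.
Proof. by rewrite /gmul big1 // => u _; rewrite msupp0 big_seq_fset0. Qed.

Let gmul_suml I (s : seq I) (F : I -> {malg K[G]}) g :
  gmul (\sum_(i <- s) F i) g = \sum_(i <- s) gmul (F i) g.
Proof. exact: (big_morph (gmul^~ g) (fun _ _ => gmulDl _ _ _) (gmul0r _)). Qed.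

Let gmul_sumr I (s : seq I) (F : I -> {malg K[G]}) g :
  gmul g (\sum_(i <- s) F i) = \sum_(i <- s) gmul g (F i).
Proof. exact: (big_morph (gmul g) (fun _ _ => gmulDr _ _ _) (gmulr0 _)). Qed.

Fact gmulA : associative gmul.
Proof.
move=> f g h; rewrite [f]monalgE !gmul_suml; apply/eq_bigr=> u _.
rewrite [g]monalgE gmul_suml !gmul_sumr gmul_suml; apply/eq_bigr=> v _.
rewrite [h]monalgE !gmul_sumr; apply/eq_bigr=> w _.
by rewrite !gmulUU mulrA mulgA.
Qed.

Definition gone : {malg K[G]} := << 1%g >>.

Fact gmul1r : left_id gone gmul.
Proof.
move=> f; rewrite [f]monalgE gmul_sumr; apply/eq_bigr=> u _.
by rewrite gmulUU mul1r mul1g.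
Qed.

Fact gmulr1 : right_id gone gmul.
Proof.
move=> f; rewrite [f]monalgE gmul_suml; apply/eq_bigr=> u _.
by rewrite gmulUU mulr1 mulg1.
Qed.

Fact gone_neq0 : gone != 0.
Proof. by rewrite monalgU_eq0 oner_eq0. Qed.

HB.instance Definition _ := GRing.Zmodule_isNzRing.Build {galg K[G]}
  gmulA gmul1r gmulr1 gmulDl gmulDr gone_neq0.

Lemma gmulE (f g : {galg K[G]}) : f * g =
  \sum_(u <- msupp f) \sum_(v <- msupp g) << f@_u * g@_v *g (u * v)%g >>.
Proof. by []. Qed.

End GroupAlgebra.

(* A well-order is given by its reflexive relation R x y, read x <= y. *)
Definition strict (T : Type) (R : rel T) (x y : T) : Prop := R x y /\ x <> y.

Section Orders.
Variables (T : Type) (R : rel T).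
Implicit Types (A B : set T).

(* A `+` B is the symmetric difference. *)
Definition min_lt A B :=
  exists2 m, minimum_of R [in A `+` B] m & A m.
Definition min_le A B := A = B \/ min_lt A B.

Definition max_lt A B :=
  exists2 m, maximum_of R [in A `+` B] m & B m.
Definition max_le A B := A = B \/ max_lt A B.

Lemma well_order_wf : well_order R -> well_founded (strict R).
Proof.
move=> Rwo; have Ranti x y : R x y -> R y x -> x = y.
  move=> Rxy Ryx.
  have := @wo_chain_antisymmetric {classic T} R predT (fun (B : {pred {classic T}}) _ => Rwo B) x y.
  by move=> /(_ isT isT); apply; rewrite Rxy.
move=> x; apply: contrapT => nAx.
have [|z [[/asboolP nAz zmin] _]] := Rwo (fun y => `[< ~ Acc (strict R) y >]).
  by exists x; apply/asboolP.
apply: nAz; constructor=> y [Ryz yz]; apply: contrapT => nAy.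
by apply: yz; apply: Ranti Ryz _; apply: zmin; apply/asboolP.
Qed.

End Orders.

Section Exposure.
Variables (K : fieldType) (S : choiceType).
Local Notation F := (free_group S).
Local Notation A := {galg K[F]}.
Variable R : rel F.
Implicit Types (u v w : F) (f g : A) (T : set F) (I X : set A).

(* The product u' v has no cancellation iff the concatenation is reduced; u v
   is the product in F, where cancellation is allowed. *)
Definition suffix_invariant := forall u u' v,
  strict R u u' -> reduced (word u' ++ word v) -> strict R (u * v)%g (u' * v)%g.

Definition supp f : set F := [set u | f@_u != 0].

Definition Sp T : set A := [set f | exists (d : {fset F}) (c : F -> K),
  [set u | u \in d] `<=` T /\ f = \sum_(u <- d) c u *: (<< u >> : A)].

Lemma SpE T : Sp T = [set f | supp f `<=` T].
Proof.
have UZ (c : K) u : c *: (<< u >> : A) = << c *g u >>.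
  by apply/malgP => v; rewrite mcoeffZ !mcoeffU mulrnAr mulr1.
apply/seteqP; split=> f /= => [[d [c [dT ->]]] u|fT].
  move=> cu; apply: dT; apply: contrapT => /negP ud; move/negP: cu; apply.
  rewrite /= raddf_sum big1_seq//= => v vd.
  by rewrite UZ mcoeffU; case: eqVneq ud => // <-; rewrite vd.
exists (msupp f), (fun u => f@_u); split.
  by move=> u /=; rewrite -mcoeff_neq0; apply: fT.
by rewrite [LHS]monalgE; apply: eq_bigr => u _; rewrite UZ.
Qed.

Definition is_monic f := exists2 u, maximum_of R [in supp f] u & f@_u = 1.

Definition right_ideal I :=
  [/\ I 0, forall f g, I f -> I g -> I (f - g) & forall f g, I f -> I (f * g)].

Definition gen_right_ideal X : set A := smallest right_ideal X.

Definition coset I f : set A := [set f + h | h in I].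

Definition schreier_transversal I T :=
  [/\ forall u v, prefix (word u) (word v) -> T v -> T u,
      Sp T `&` I = [set 0] &
      forall f, coset I f `&` Sp T !=set0].

(* xget d P is some element of P, or d if P is empty: in the definitions below
   P is meant to be a singleton. *)
Definition min_transversal I : set F :=
  xget set0 [set T | schreier_transversal I T /\
                     forall T', schreier_transversal I T' -> min_le R T T'].

Definition remainder I f : A :=
  xget 0 [set g | coset I f g /\ supp g `<=` min_transversal I].

Definition min_supp X : set A :=
  [set f | X f /\ forall g, X g -> max_le R (supp f) (supp g)].

(* One step of the exposure process of I, X being the set of the f_beta with
   beta < alpha. *)
Definition exposure_next I X : A :=
  xget 0 (min_supp [set f | [/\ I f, is_monic f &
    supp f `<=` min_transversal (gen_right_ideal X)]]).

(* Ordinals are represented as the elements of an arbitrary well-ordered type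
   W. The recursion is total on W; its values from omega_I on are junk, and
   before_stop singles out the alpha < omega_I. *)
Section Process.
Variables (I : set A) (W : Type) (leW : rel W) (woW : well_order leW).
Implicit Types (a b : W).

Definition exposure : W -> A :=
  Fix (well_order_wf woW) (fun=> A) (fun a rec =>
    exposure_next I [set f | exists b (ltba : strict leW b a), f = rec b ltba]).

Lemma exposureE a :
  exposure a = exposure_next I (exposure @` [set b | strict leW b a]).
Proof.
rewrite /exposure Fix_eq => [|{}a r1 r2 r12].
  congr exposure_next; apply/seteqP; split=> f.
    by case=> b [ltba ->]; exists b.
  by case=> b ltba <-; exists b, ltba.
congr exposure_next; apply/seteqP; split=> f [b [ltba ->]]; exists b, ltba;
  by rewrite r12.
Qed.

Definition exposure_ideal a : set A :=
  gen_right_ideal (exposure @` [set b | strict leW b a]).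

Definition before_stop a := forall b, leW b a -> exposure_ideal b <> I.

End Process.

End Exposure.

(* Main.v *)
(** By suffix-invariance the head words of elements of a right ideal I are
closed under extension: if f in I has head u and uw is reduced, then f w has
head uw. So the words that are not heads form a prefix-closed set N. Rewriting
heads by smaller words shows that every g is congruent mod I to some r
supported on N, each word of r being at most some word of g, and a nonzero
element of I is never supported on N; hence N is the minimal Schreier
transversal. If r is supported on N and g is another element of r + I, the
head of g - r lies in supp g but not in supp r, and above it the two supports
agree; this gives (1) and (2). For (3), with J = I_alpha and u the least word
that is a head of I but not of J, the element u - phi_I(u) is minimal among
the monic elements of I \ J; it is supported on T_J, and the elements of I
supported on T_J are in I \ J or zero, so it is also the element chosen by the
exposure process. *)

Require Import Defs.
From HB Require Import structures.
From mathcomp Require Import all_boot all_order all_algebra.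
From mathcomp Require Import finmap.
From mathcomp Require Import all_classical wochoice.
From mathcomp Require Import monalg.

Set Implicit Arguments.
Unset Strict Implicit.
Unset Printing Implicit Defensive.

Import GRing.Theory.

Local Open Scope classical_set_scope.
Local Open Scope ring_scope.

(** * Well-orders and the comparisons of sets that they induce *)

Section WellOrder.
Variables (T : eqType) (R : rel T).
Hypothesis woR : well_order R.
Implicit Types (A B X : set T) (x y z m : T).

Lemma wo_total x y : R x y \/ R y x.
Proof. by apply/orP/(@wo_chainW T R predT) => // X _; apply: woR. Qed.

Lemma wo_refl x : R x x.
Proof. by case: (wo_total x x). Qed.

Lemma wo_anti x y : R x y -> R y x -> x = y.
Proof.
move=> Rxy Ryx; apply: (@wo_chain_antisymmetric T R predT) => //.
  by move=> X _; apply: woR.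
by rewrite Rxy.
Qed.

(** The least element of {x, y, z} settles it: if it is y or z, antisymmetry identifies two of the
    three points. *)
Lemma wo_trans y x z : R x y -> R y z -> R x z.
Proof.
move=> Rxy Ryz; have [|m [[mE mR] _]] := woR (A := [in [:: x; y; z]]).
  by exists x; rewrite inE eqxx.
have := mR z; have := mR y; have := mR x; rewrite !inE !eqxx !orbT.
move: mE; rewrite !inE => /or3P[] /eqP-> {m mR} Rx Ry Rz; first exact: Rz.
  by rewrite (wo_anti Rxy (Rx isT)).
by rewrite -(wo_anti Ryz (Ry isT)).
Qed.

Lemma wo_not x y : ~ R y x -> strict R x y.
Proof.
move=> nRyx; case: (wo_total x y) => // Rxy; split=> // exy.
by apply: nRyx; rewrite exy wo_refl.
Qed.

Lemma strict_not x y : strict R x y -> ~ R y x.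
Proof. by case=> Rxy nxy /(wo_anti Rxy). Qed.

Lemma maximum_ofP A m :
  maximum_of R [in A] m <-> A m /\ forall x, A x -> R x m.
Proof.
split=> -[Am mA]; (split; first by move: Am; rewrite inE) => x Ax.
  by apply: mA; rewrite inE.
by apply: mA; move: Ax; rewrite inE.
Qed.

Lemma minimum_ofP A m :
  minimum_of R [in A] m <-> A m /\ forall x, A x -> R m x.
Proof.
split=> -[Am mA]; (split; first by move: Am; rewrite inE) => x Ax.
  by apply: mA; rewrite inE.
by apply: mA; move: Ax; rewrite inE.
Qed.

Lemma minimum_ex A : A !=set0 -> exists m, minimum_of R [in A] m.
Proof.
case=> x Ax; have [|m [mA _]] := woR (A := [in A]); last by exists m.
by exists x; rewrite inE.
Qed.

Lemma seq_maximum_ex (s : seq T) x :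
  x \in s -> exists2 m, m \in s & {in s, forall y, R y m}.
Proof.
elim: s x => // y [_ _ _|z s /(_ z (mem_head _ _))[m ms sm] x _].
  by exists y; rewrite ?mem_head// => z; rewrite inE => /eqP->; apply: wo_refl.
have [Rym|Rmy] := wo_total y m.
  by exists m => [|t]; rewrite inE ?ms ?orbT// => /predU1P[->//|/sm].
exists y => [|t]; rewrite inE ?eqxx// => /predU1P[->|/sm Rtm].
  exact: wo_refl.
exact: wo_trans Rtm Rmy.
Qed.

Lemma max_ltP A B m : B m -> ~ A m ->
  (forall x, strict R m x -> (A x <-> B x)) -> max_lt R A B.
Proof.
move=> Bm nAm AB; exists m => //; apply/maximum_ofP; split; first by right.
move=> x ABx; apply: contrapT => /wo_not /AB [AB1 AB2].
by case: ABx => -[] => [/AB1|/AB2].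
Qed.

Lemma max_lt_not_le A B : max_lt R A B -> ~ max_le R B A.
Proof.
case=> m /maximum_ofP[ABm mAB] Bm [eBA|[n /maximum_ofP[BAn nBA] An]].
  by move: ABm; rewrite eBA setYK.
have emn : m = n.
  by apply: wo_anti; [apply: nBA; rewrite setYC | apply: mAB; rewrite setYC].
by case: ABm => -[]; rewrite emn // in Bm *.
Qed.

Lemma min_le_anti A B : min_le R A B -> min_le R B A -> A = B.
Proof.
move=> [//|[m /minimum_ofP[ABm mAB] Am]].
move=> [//|[n /minimum_ofP[BAn nBA] Bn]].
have emn : m = n.
  by apply: wo_anti; [apply: mAB; rewrite setYC | apply: nBA; rewrite setYC].
by case: ABm => -[]; rewrite emn // in Am *.
Qed.

End WellOrder.

(** * Right ideals, cosets and supports in the group algebra *)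

Section RightIdeal.
Variables (K : fieldType) (S : choiceType).
Local Notation F := (free_group S).
Local Notation A := {galg K[F]}.
Implicit Types (u v w : F) (f g h : A) (I J X : set A) (c : K).

(** Right translation by [v] is injective on [F], so only the word [w * v^-1] of [f] contributes to
    the coefficient at [w]. *)
Lemma mcoeff_mulU f c v w :
  (f * (<< c *g v >> : A))@_w = f@_(w * v^-1)%g * c.
Proof.
have -> : f * (<< c *g v >> : A) =
    \sum_(u <- msupp f) << f@_u * c *g (u * v)%g >> :> {malg K[F]}.
  rewrite [LHS](gmulw (fsubset_refl _) msuppU_le).
  by apply: eq_bigr => u _; rewrite big_seq_fset1 mcoeffUU.
rewrite raddf_sum /=
  (eq_bigr (fun u => f@_u * c *+ (u == w * v^-1)%g)); last first.
  by move=> u _; rewrite mcoeffU -[in RHS](inj_eq (mulIg v)) mulgVK.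
have [wf|wf] := boolP ((w * v^-1)%g \in msupp f); last first.
  rewrite (mcoeff_outdom wf) mul0r big1_seq // => u /= uf.
  by case: eqP uf wf => // -> ->.
rewrite (big_fsetD1 _ wf) /= eqxx mulr1n big1_fset ?addr0// => u.
by rewrite !inE => /andP[/negbTE->].
Qed.

(** This makes right ideals closed under scalars, a closure that [right_ideal] does not list. *)
Lemma mul_scaleU f c : f * (<< c *g 1%g >> : A) = c *: f.
Proof.
apply/malgP => w; rewrite mcoeff_mulU invg1 mulg1 mulrC.
by rewrite [RHS]mcoeffZ.
Qed.

Section Closure.
Variable I : set A.
Hypothesis rI : right_ideal I.

Lemma right_ideal0 : I 0. Proof. by case: rI. Qed.

Lemma right_idealB f g : I f -> I g -> I (f - g).
Proof. by case: rI => _ + _; apply. Qed.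

Lemma right_idealN f : I f -> I (- f).
Proof. by move=> If; rewrite -sub0r; apply/right_idealB/If/right_ideal0. Qed.

Lemma right_idealD f g : I f -> I g -> I (f + g).
Proof. by move=> If Ig; rewrite -[g]opprK; apply/right_idealB/right_idealN. Qed.

Lemma right_idealM f g : I f -> I (f * g).
Proof. by case: rI => _ _; apply. Qed.

Lemma right_idealZ c f : I f -> I (c *: f).
Proof. by rewrite -mul_scaleU; apply: right_idealM. Qed.

Lemma right_ideal_sum (s : seq F) (f : F -> A) :
  (forall v, v \in s -> I (f v)) -> I (\sum_(v <- s) f v).
Proof.
move=> If; rewrite big_seq; apply: big_ind => //; first exact: right_ideal0.
exact: right_idealD.
Qed.

Lemma cosetE f g : coset I f g <-> I (g - f).
Proof.
split=> [[h Ih <-]|Igf]; first by rewrite addrC addKr.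
by exists (g - f) => //; rewrite addrC subrK.
Qed.

Lemma cosetB f g h : coset I f g -> coset I f h -> I (g - h).
Proof.
move=> /cosetE Ig /cosetE Ih.
by have := right_idealB Ig Ih; rewrite opprB addrA subrK.
Qed.

End Closure.

Lemma right_ideal_gen X : right_ideal (gen_right_ideal X).
Proof.
split=> [J [[] //]|f g If Ig J|f g If J] JX; have [[J0 JB JM] _] := JX.
  by apply: JB; [apply: If | apply: Ig].
by apply: JM; apply: If.
Qed.

Lemma supp_eq0 f : supp f = set0 -> f = 0.
Proof.
move=> f0; apply/malgP => u; rewrite mcoeff0.
by apply: contrapT => /eqP fu; have : supp f u by []; rewrite f0.
Qed.

Lemma suppB f g u : supp (f - g) u -> supp f u \/ supp g u.
Proof.
rewrite /supp /= mcoeffB; case: (eqVneq f@_u 0) => [->|]; last by left.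
by rewrite sub0r oppr_eq0; right.
Qed.

Lemma suppZ c f : c != 0 -> supp (c *: f) = supp f.
Proof.
move=> c0; apply/seteqP; split=> u;
  by rewrite /supp /= mcoeffZ mulf_eq0 (negbTE c0).
Qed.

Lemma suppU u : supp (<< u >> : A) = [set u].
Proof.
apply/seteqP; split=> v; rewrite /supp /= mcoeffU.
  by case: (eqVneq u v) => //=; rewrite eqxx.
by move=> ->; rewrite eqxx oner_eq0.
Qed.

End RightIdeal.

(** * Head words of a right ideal *)

Section Heads.
Variables (K : fieldType) (S : choiceType).
Local Notation F := (free_group S).
Local Notation A := {galg K[F]}.
Variable R : rel F.
Hypothesis woR : well_order R.
Implicit Types (u v w : F) (f g h r : A) (I J X : set A) (T : set F).

Definition heads I : set F :=
  [set u | exists2 f, I f & maximum_of R [in supp f] u].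

(** [r] is a normal form of [g] modulo [I]. The last clause keeps rewriting from producing words
    above those of [g]; all minimality arguments rest on it. *)
Definition reduction I g r :=
  [/\ I (g - r), supp r `<=` ~` heads I &
      forall w, supp r w -> exists2 v, supp g v & R w v].

Lemma head_ex f : f <> 0 -> exists u, maximum_of R [in supp f] u.
Proof.
move=> f0; have [u fu] : supp f !=set0.
  by apply/set0P/eqP => /supp_eq0.
have /(seq_maximum_ex woR)[m mf fm] : u \in msupp f by rewrite -mcoeff_neq0.
exists m; apply/maximum_ofP; split; first by rewrite /supp /= mcoeff_neq0.
by move=> v fv; apply: fm; rewrite -mcoeff_neq0.
Qed.

Lemma heads_ex I f : I f -> f <> 0 ->
  exists u, [/\ heads I u, supp f u & forall v, supp f v -> R v u].
Proof.
move=> If /head_ex[u fu]; exists u; have /maximum_ofP[fu' uf] := fu.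
by split=> //; exists f.
Qed.

Lemma heads_monic I u : right_ideal I -> heads I u ->
  exists f, [/\ I f, f@_u = 1 & maximum_of R [in supp f] u].
Proof.
move=> rI [f If fu]; have /maximum_ofP[fu0 _] := fu.
exists ((f@_u)^-1 *: f); split; first exact: right_idealZ.
  by rewrite mcoeffZ mulVf.
by rewrite suppZ // invr_eq0.
Qed.

Lemma supp_sum (s : seq F) (f : F -> A) w : supp (\sum_(v <- s) f v) w ->
  exists2 v, v \in s & supp (f v) w.
Proof.
move=> sw; apply: contrapT => nf; move: sw; rewrite /supp /= raddf_sum /=.
rewrite big1_seq ?eqxx// => v /= vs; apply: contrapT => /eqP fv.
by apply: nf; exists v.
Qed.

(** The two coefficients at [u] cancel. For [f] in [I] this is the rewriting rule that replaces [u]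
    by smaller words. *)
Lemma suppUB_lt f u v : maximum_of R [in supp f] u -> f@_u = 1 ->
  supp ((<< u >> : A) - f) v -> strict R v u.
Proof.
move=> /maximum_ofP[_ fu] fu1 uv; split.
  by case: (suppB uv); [rewrite suppU => ->; apply: wo_refl | apply: fu].
by move=> evu; move: uv; rewrite /supp /= evu mcoeffB mcoeffUU fu1 subrr eqxx.
Qed.

(** * Normal forms modulo a right ideal and the minimal Schreier transversal *)

Section Reduction.
Variable I : set A.
Hypothesis rI : right_ideal I.

Lemma head_free_eq0 f : I f -> supp f `<=` ~` heads I -> f = 0.
Proof.
move=> If fI; apply: contrapT => /(heads_ex If)[u [Iu fu _]].
exact: fI Iu.
Qed.

Lemma reduction_sum g :
    (forall v, supp g v -> exists r, reduction I << v >> r) ->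
  exists r, reduction I g r.
Proof.
move=> gr; have /choice[r rP] v : exists r, supp g v -> reduction I << v >> r.
  (* The value 0 off the support of [g] only serves to make the choice function total. *)
  by have [/gr[r rP]|ngv] := pselect (supp g v); [exists r | exists 0].
have {rP gr}rP v : v \in msupp g -> reduction I << v >> (r v).
  by move=> vg; apply: rP; rewrite /supp /= mcoeff_neq0.
have supp_r w : supp (\sum_(v <- msupp g) g@_v *: r v) w ->
    exists2 v, v \in msupp g & supp (r v) w.
  move=> /supp_sum[v vg vw]; exists v => //; move: vw.
  by rewrite suppZ// mcoeff_neq0.
exists (\sum_(v <- msupp g) g@_v *: r v); split.
- have -> : g - \sum_(v <- msupp g) g@_v *: r v =
      \sum_(v <- msupp g) g@_v *: ((<< v >> : A) - r v).
    rewrite (eq_bigr _ (fun v _ => scalerBr _ _ _)) sumrB; congr (_ - _).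
    rewrite [LHS]monalgE; apply: eq_bigr => v _; apply/malgP => w.
    by rewrite [RHS]mcoeffZ !mcoeffU mulrnAr mulr1.
  apply: right_ideal_sum => // v vg; apply: right_idealZ => //.
  by have [] := rP v vg.
- by move=> w /supp_r[v /rP[_ + _]]; apply.
move=> w /supp_r[v vg rw]; have [_ _ /(_ w rw)[v']] := rP v vg.
by rewrite suppU => -> Rwv; exists v => //; rewrite /supp /= mcoeff_neq0.
Qed.

(** Well-founded induction: a head [u] is replaced by [<< u >> - f], whose words are smaller and
    hence already reducible; any other word is its own normal form. *)
Lemma reduction_word u : exists r, reduction I << u >> r.
Proof.
elim/(well_founded_induction (well_order_wf woR)): u => u IH.
have [/(heads_monic rI)[f [If fu1 fu]]|nIu] :=
  pselect (heads I u); last first.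
  exists << u >>; split; first by rewrite subrr; apply: right_ideal0.
    by rewrite suppU => v ->.
  by move=> w uw; exists w => //; apply: wo_refl.
have lt_u v := @suppUB_lt f u v fu fu1.
have [v /lt_u/IH//|r [Ir rI' rb]] := @reduction_sum (<< u >> - f).
exists r; split=> //.
  by have := right_idealD rI Ir If; rewrite addrAC subrK.
move=> w /rb[v /lt_u[Rvu _] Rwv]; exists u; first by rewrite suppU.
exact: wo_trans Rwv Rvu.
Qed.

Lemma reduction_ex g : exists r, reduction I g r.
Proof. by apply: reduction_sum => v _; apply: reduction_word. Qed.

(** Otherwise the least word [m] of the symmetric difference is a head lying in [T]. Its normal form
    [r] uses non-heads below [m], which belong to [T] by the choice of [m], so [<< m >> - r] is a
    nonzero element of [I] supported on [T]. *)
Lemma min_le_head_free T : schreier_transversal I T ->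
  min_le R (~` heads I) T.
Proof.
move=> [_ TI _]; have [->|neT] := pselect (~` heads I = T); first by left.
right; have [|m mM] := @minimum_ex _ _ woR ((~` heads I) `+` T).
  apply/set0P/eqP => e; apply: neT; apply/seteqP; split=> x Tx;
    apply: contrapT => nTx; suff : set0 x by []; rewrite -e.
  by left.
by right.
exists m => //; have /minimum_ofP[[[]//|[Tm nTm]] minm] := mM.
have {}nTm : heads I m by apply: contrapT.
have [f [If fm1 fm]] := heads_monic rI nTm.
have lt_T w : ~ heads I w -> strict R w m -> T w.
  move=> nIw /(strict_not woR) nRmw; apply: contrapT => nTw; apply: nRmw.
  by apply: minm; left.
have [r [Ir rI' rb]] := reduction_ex (<< m >> - f).
have lt_m v := @suppUB_lt f m v fm fm1.
have lt_r w : supp r w -> strict R w m.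
  move=> /rb[v /lt_m vm Rwv]; apply: (wo_not woR) => Rmw.
  by apply: (strict_not woR vm); apply: wo_trans Rmw Rwv.
have : (Sp T `&` I) (<< m >> - r).
  split; last by have := right_idealD rI Ir If; rewrite addrAC subrK.
  rewrite SpE => w /suppB[|rw]; first by rewrite suppU => ->.
  by apply: lt_T; [apply: rI' | apply: lt_r].
rewrite TI => /(congr1 (fun f : A => f@_m)) /eqP.
rewrite mcoeffB mcoeffUU mcoeff0.
have -> : r@_m = 0.
  by apply: contrapT => /eqP/lt_r[_].
by rewrite subr0 oner_eq0.
Qed.

Hypothesis siR : suffix_invariant R.

(** Write [v] as [u * w] without cancellation. Suffix-invariance keeps [u * w] above every other
    word of [f * << w >>], even where those products do cancel. *)
Lemma prefix_heads u v : prefix (word u) (word v) -> heads I u -> heads I v.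
Proof.
move=> /prefixP[s ev] [f If /maximum_ofP[fu uf]].
have rs : reduced s.
  by have := valP v; rewrite /= ev => /cat_sorted2[].
pose w : F := FreeGroup rs.
have ruw : reduced (word u ++ word w) by rewrite /= -ev; apply: valP.
have -> : v = (u * w)%g by apply/val_inj; rewrite /= mul_cat //= ev.
exists (f * (<< w >> : A)); first exact: right_idealM.
apply/maximum_ofP; split; first by rewrite /supp /= mcoeff_mulU mulgK mulr1.
move=> x; rewrite /supp /= mcoeff_mulU mulr1 => fx.
have [<-|neu] := pselect ((x * w^-1)%g = u); first by rewrite mulgVK wo_refl.
have /siR/(_ ruw)[] : strict R (x * w^-1)%g u by split=> //; apply: uf.
by rewrite mulgVK.
Qed.

Lemma schreier_head_free : schreier_transversal I (~` heads I).
Proof.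
split=> [u v uv nIv /(prefix_heads uv)//||f].
  rewrite SpE; apply/seteqP; split=> f.
    by case=> fI /head_free_eq0; apply.
  move=> ->; split; last exact: right_ideal0.
  by move=> u; rewrite /supp /= mcoeff0 eqxx.
have [r [Ir rI' _]] := reduction_ex f; exists r; split; last by rewrite SpE.
by apply/cosetE; rewrite -opprB; apply: right_idealN.
Qed.

Lemma min_transversalE : min_transversal R I = ~` heads I.
Proof.
apply: xget_unique.
  by split=> [|T /min_le_head_free//]; apply: schreier_head_free.
move=> T [sT Tmin]; apply: (min_le_anti woR); last exact: min_le_head_free.
exact/Tmin/schreier_head_free.
Qed.

(** Two candidates differ by an element of [I] without heads in its support, which is zero. *)
Lemma remainder_unique f r :
  I (f - r) -> supp r `<=` ~` heads I -> remainder R I f = r.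
Proof.
move=> Ifr rI'; rewrite /remainder min_transversalE; apply: xget_unique.
  by split=> //; apply/cosetE; rewrite -opprB; apply: right_idealN.
move=> g [/cosetE Igf gI]; apply/eqP; rewrite -subr_eq0; apply/eqP.
apply: head_free_eq0 => [|u /suppB[]]; [|exact: gI|exact: rI'].
by have := right_idealD rI Igf Ifr; rewrite addrA subrK.
Qed.

Lemma remainder_reduction f : reduction I f (remainder R I f).
Proof.
by have [r [Ir rI' rb]] := reduction_ex f; rewrite (remainder_unique Ir rI').
Qed.

(** The head of [g - f] decides the comparison, since [f] and [g] have equal coefficients above it.
    Only this head has to avoid [supp f], so the lemma also covers exposed elements, whose own head
    is a head of [I]. *)
Lemma coset_max_lt f g : I (g - f) -> g <> f ->
    (forall u, maximum_of R [in supp (g - f)] u -> ~ supp f u) ->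
  max_lt R (supp f) (supp g).
Proof.
move=> Igf /eqP; rewrite -subr_eq0 => /eqP/head_ex[m hm] /(_ m hm) nfm.
have /maximum_ofP[gfm gfR] := hm.
apply: (max_ltP woR (m := m)) => // [|x mx]; first by case: (suppB gfm).
have : ~ supp (g - f) x by move=> /gfR; apply: strict_not.
by rewrite /supp /= mcoeffB => /negP/negPn; rewrite subr_eq0 => /eqP->.
Qed.

Lemma head_free_max_lt f g : I (g - f) -> g <> f ->
  supp f `<=` ~` heads I -> max_lt R (supp f) (supp g).
Proof.
by move=> Igf ngf fI; apply: coset_max_lt => // u hu /fI; apply; exists (g - f).
Qed.

Lemma head_free_min_supp :
  ~` heads I = [set u | forall g, coset I << u >> g ->
                                  max_le R [set u] (supp g)].
Proof.
apply/seteqP; split=> u /= uI => [g /cosetE Ig|].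
  have [->|ng] := pselect (g = << u >>); first by left; rewrite suppU.
  right; rewrite -(suppU K u); apply: head_free_max_lt => // v.
  by rewrite suppU => ->.
move=> /(heads_monic rI)[f [If fu1 fu]].
suff : max_lt R (supp ((<< u >> : A) - f)) [set u].
  move/(max_lt_not_le woR); apply; apply: uI; apply/cosetE.
  by rewrite addrAC subrr sub0r; apply: right_idealN.
apply: (max_ltP woR (m := u)) => // [/(suppUB_lt fu fu1)[]//|x [Rux nux]].
by split=> [/(suppUB_lt fu fu1)/(strict_not woR)|/esym].
Qed.

End Reduction.

Lemma min_supp_unique X f : X f ->
    (forall g, X g -> g <> f -> max_lt R (supp f) (supp g)) ->
  min_supp R X = [set f].
Proof.
move=> Xf fX; apply/seteqP; split=> g /= => [[Xg gX]|->].
  by apply: contrapT => /(fX g Xg)/(max_lt_not_le woR); apply; apply: gX.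
split=> // h Xh; have [->|/(fX h Xh)] := pselect (h = f); first by left.
by right.
Qed.

(** * Minimal supports in cosets and in the exposure process *)

Section Exposure.
Hypothesis siR : suffix_invariant R.

Lemma min_supp_coset I f : right_ideal I ->
  min_supp R (coset I f) = [set remainder R I f].
Proof.
move=> rI; have [Ir rI' _] := remainder_reduction rI siR f.
have Irf : coset I f (remainder R I f).
  by apply/cosetE; rewrite -opprB; apply: right_idealN.
apply: min_supp_unique => // g Ig ngr.
by apply: head_free_max_lt ngr rI'; apply: cosetB Ig Irf.
Qed.

(** One [f] is minimal in all of [I] outside [J] and also avoids the heads of [J], so it answers
    both the claim and the definition of the exposure step. *)
Lemma exposed_ex I J : right_ideal I -> right_ideal J -> J `<=` I -> J <> I ->
  exists f, [/\ (I `\` J) f, is_monic R f, supp f `<=` ~` heads J &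
    forall g, (I `\` J) g -> is_monic R g -> g <> f ->
      max_lt R (supp f) (supp g)].
Proof.
move=> rI rJ JI nJI.
have headJI v : heads J v -> heads I v by case=> f /JI If fv; exists f.
(* Reducing [g] modulo [J] leaves a nonzero element of [I]; its head is a head of [I] but not of
   [J]. *)
have head_diff g : (I `\` J) g ->
    exists2 w, (heads I `\` heads J) w & exists2 v, supp g v & R w v.
  move=> [Ig nJg]; have [r [Jr rJ' rb]] := reduction_ex rJ g.
  have Ir : I r.
    by have := right_idealB rI Ig (JI _ Jr); rewrite opprB addrC subrK.
  have [r0|w [Iw rw _]] := heads_ex Ir.
    by apply: nJg; rewrite r0 subr0 in Jr.
  by exists w; [split=> //; apply: rJ' | apply: rb].
have [g IJg] : (I `\` J) !=set0.
  by apply/set0P/eqP; rewrite setD_eq0 => IJ; apply: nJI; apply/seteqP.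
have [w IJw _] := head_diff g IJg.
have [|u /minimum_ofP[[Iu nJu] umin]] :=
    @minimum_ex _ _ woR (heads I `\` heads J).
  by exists w.
have [h [Ih hu1 hu]] := heads_monic rI Iu.
have [r [Ir rI' rb]] := reduction_ex rI (<< u >> - h).
have lt_r v : supp r v -> strict R v u.
  move=> /rb[x /(suppUB_lt hu hu1) xu Rvx]; apply: (wo_not woR) => Ruv.
  by apply: (strict_not woR xu); apply: wo_trans Ruv Rvx.
pose f : A := << u >> - r.
have fu1 : f@_u = 1.
  rewrite mcoeffB mcoeffUU; have -> : r@_u = 0; last by rewrite subr0.
  by apply: contrapT => /eqP/lt_r[].
have supp_f v : supp f v -> v = u \/ supp r v.
  by move=> /suppB[|]; [rewrite suppU; left | right].
have If : I f by have := right_idealD rI Ir Ih; rewrite addrAC subrK.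
have fu : maximum_of R [in supp f] u.
  apply/maximum_ofP; split; first by rewrite /supp /= fu1 oner_eq0.
  by move=> v /supp_f[->|/lt_r[]//]; apply: wo_refl.
have nJf : ~ J f by move=> Jf; apply: nJu; exists f.
exists f; split=> //.
- by exists u.
- by move=> v /supp_f[->//|/rI' + /headJI].
move=> g' IJg' [w' gw' gw1] ngf; have [Ig' _] := IJg'.
have /maximum_ofP[gw gR] := gw'.
have Ruw : R u w'.
  have [x IJx [v /gR Rvw Rxv]] := head_diff g' IJg'.
  exact: wo_trans (umin x IJx) (wo_trans woR Rxv Rvw).
have /maximum_ofP[_ fR] := fu.
(* With equal heads the leading 1s cancel, so the head of [g' - f] is a head of [I] other than [u],
   and [supp f] contains no such word. *)
have [euw|nuw] := pselect (u = w').
  apply: (coset_max_lt (I := I)) => // [|v gfv]; first exact: right_idealB.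
  have Iv : heads I v by exists (g' - f) => //; apply: right_idealB.
  have /maximum_ofP[gfv' _] := gfv.
  move=> /supp_f[evu|/rI'//].
  by move: gfv'; rewrite /supp /= evu mcoeffB fu1 euw gw1 subrr eqxx.
(* Here [u] is strictly below [w'], so [w'] itself decides the comparison. *)
have lt_f v : supp f v -> ~ R w' v.
  move=> /fR Rvu Rwv; apply: nuw; apply: (wo_anti woR) => //.
  exact: wo_trans Rwv Rvu.
apply: (max_ltP woR (m := w')) => // [/lt_f|x wx].
  by apply; apply: wo_refl.
by split=> [/lt_f|/gR/(strict_not woR wx)//]; case: wx.
Qed.

Lemma exposure_nextE I X : right_ideal I -> X `<=` I ->
    gen_right_ideal X <> I ->
  min_supp R [set f | (I `\` gen_right_ideal X) f /\ is_monic R f] =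
    [set exposure_next R I X].
Proof.
move=> rI XI nXI; have rX := right_ideal_gen X.
have XI' : gen_right_ideal X `<=` I by apply: smallest_sub.
have [f [IXf mf fX fmin]] := exposed_ex rI rX XI' nXI.
rewrite (@min_supp_unique _ f) //; last by move=> g [IXg mg]; apply: fmin.
rewrite /exposure_next min_transversalE // (@min_supp_unique _ f).
- by rewrite (@xget_unique _ 0 [set f] f).
- by split=> //; case: IXf.
(* A monic element supported off the heads of [J] cannot lie in [J], as it would be zero. *)
move=> g [Ig mg gX]; apply: fmin => //; split=> // Jg.
have g0 := head_free_eq0 Jg gX.
by case: mg => u _ /eqP; rewrite g0 mcoeff0 eq_sym oner_eq0.
Qed.

(** This holds past the stopping point too, since the default value 0 of [xget] lies in [I]. *)
Lemma exposure_sub (I : set A) (W : Type) (leW : rel W) (woW : well_order leW)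
  (a : W) : right_ideal I -> I (exposure R I woW a).
Proof.
move=> rI; rewrite exposureE /exposure_next.
by case: xgetP => [f _ [[]]//|_]; apply: right_ideal0.
Qed.

End Exposure.

End Heads.

Theorem theorem3p55 (K : fieldType) (S : finType) (R : rel (free_group S))
    (woR : well_order R) (siR : suffix_invariant R)
    (I : set {galg K[free_group S]}) (rI : right_ideal I) :
  [/\ min_transversal R I =
        [set u : free_group S | forall g : {galg K[free_group S]},
          coset I << u >> g -> max_le R [set u] (supp g)],
      forall f : {galg K[free_group S]},
        min_supp R (coset I f) = [set remainder R I f] &
      forall (W : Type) (leW : rel W) (woW : well_order leW) (alpha : W),
        before_stop R I woW alpha ->
        min_supp R [set f | (I `\` exposure_ideal R I woW alpha) f /\
                            is_monic R f] =
          [set exposure R I woW alpha]].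
Proof.
split=> [|f|W leW woW alpha stop].
- by rewrite min_transversalE // head_free_min_supp.
- exact: min_supp_coset.
rewrite exposureE; apply: exposure_nextE => // [_ [b _ <-]|].
  exact: exposure_sub.
(* [{classic W}] supplies the decidable equality that [wo_refl] expects of its type. *)
apply: stop; exact: (@wo_refl {classic W} leW woW).
Qed.
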